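(* Let $G$ be a finite simple $2$-edge connected graph and let $v \in V(G)$. If $d(v)$ is odd, then there is a cycle of even length in $G$ containing $v$.
   Context: Graphs are finite, simple (no loops, no multiple edges). $d(v)$ denotes the degree of $v$. A graph is $2$-edge connected if it is connected and remains connected whenever fewer than $2$ edges are removed. The length of a cycle is its number of edges. *)

(* Defs.v *)
From mathcomp Require Import all_boot.

Set Implicit Arguments.
Unset Strict Implicit.
Unset Printing Implicit Defensive.

Record sgraph := SGraph {
  vertex :> finType;
  adj : rel vertex;
  adj_sym : symmetric adj;
  adj_irrefl : irreflexive adj
}.

Definition degree (G : sgraph) (v : G) : nat := #|[set w | adj v w]|.

(* An edge is the unordered pair of its two endpoints. *)
Definition edges (G : sgraph) : {set {set G}} :=
  [set [set p.1; p.2] | p : G * G & adj p.1 p.2].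

Definition del_edges (G : sgraph) (F : {set {set G}}) : rel G :=
  fun x y => adj x y && ([set x; y] \notin F).

Definition connected (T : finType) (e : rel T) : Prop :=
  forall x y : T, connect e x y.

Definition edge_connected (k : nat) (G : sgraph) : Prop :=
  connected (@adj G) /\
  forall F : {set {set G}}, F \subset edges G -> #|F| < k ->
    connected (del_edges F).

(* A cycle is listed by its distinct vertices in cyclic order; since it has at
   least three of them, size c is also its number of edges. The bound is needed
   because ucycle also accepts the empty list and both orders of a single
   edge, [:: x; y] and [:: y; x]. *)
Definition is_cycle (G : sgraph) (c : seq G) : Prop :=
  2 < size c /\ ucycle (@adj G) c.

(* Main.v *)
(** Say that a component of G - v has k neighbours of v.  Since G has no bridge,
    k <> 1.  If k >= 3, three of these neighbours are joined in G - v by a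
    subdivided star with legs of lengths p, q, r (possibly 0).  As
    (p + q) + (p + r) + (q + r) is even, one of the three leaf-to-leaf paths has
    even length, and closes through v to an even cycle.  Otherwise k = 2 for
    every component meeting the neighbourhood of v, so d(v) is even. *)
Require Import Defs.
From mathcomp Require Import all_boot.

(** Cut the walk at its last visit to [A]. Growing the walk at its right end, the cut restarts at
    each new vertex in [A]; otherwise the tail is extended and shortened, which only drops vertices
    and so keeps it off [A]. *)
Lemma path_last_exit {T : finType} (e : rel T) (A : {pred T}) x s :
    path e x s -> x \in A ->
  exists w r, [/\ w \in A, path e w r, last w r = last x s,
                  uniq (w :: r) & all [predC A] r].
Proof.
move=> + xA; elim/last_ind: s => [|s y IHs]; first by exists x, [::].
rewrite rcons_path last_rcons => /andP[/IHs[w [r [wA pr lr _ rA]]] exy].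
have [yA|yA] := boolP (y \in A); first by exists y, [::].
have pry: path e w (rcons r y) by rewrite rcons_path pr lr.
have := last_rcons w r y; case: (shortenP pry) => r' pr' ur' sub lr'.
exists w, r'; split=> //.
apply/allP=> z /sub; rewrite mem_rcons inE => /predU1P[->//|].
by move/(allP rA).
Qed.

(** Take a simple path from [a] to [b] and let [w] be the last vertex on it of a path from [a] to
    [c]. Then [w] splits the first path into two legs, and the rest of the second is the third
    leg. *)
Lemma connect_tripod {T : finType} (e : rel T) a b c :
    symmetric e -> connect e a b -> connect e a c ->
  exists w p q r, [/\ [/\ path e w p, path e w q & path e w r],
    [/\ last w p = a, last w q = b & last w r = c] & uniq (w :: p ++ q ++ r)].
Proof.
move=> e_sym /connectP[s0 ps0 ->] /connectP[t pt ->].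
have [s ps us _] := shortenP ps0.
have [w [r [wA pr lr ur rA]]] :=
  path_last_exit e (mem (a :: s)) a t pt (mem_head _ _).
move: ps us rA; case/splitPl: wA => p1 p2 lp1.
rewrite cat_path lp1 => /andP[pp1 pp2] us rA.
(* The leg towards [a] is the initial segment [a :: p1] read backwards, without its end [w]. *)
exists w, (rev (belast a p1)), p2, r; split.
- split=> //; rewrite -lp1 rev_path.
  by rewrite (eq_path (e' := e)) // => x y; rewrite e_sym.
- split=> //; last by rewrite last_cat lp1.
  by case: (p1) lp1 => [|y p] //= _; rewrite rev_cons last_rcons.
- have /perm_uniq->: perm_eq (w :: rev (belast a p1) ++ p2 ++ r)
                             ((a :: p1 ++ p2) ++ r).
    rewrite -cat_cons catA perm_cat2r -!cat_cons perm_cat2r (lastI a p1) lp1.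
    by rewrite perm_sym perm_rcons perm_cons perm_sym perm_rev.
  move: ur; rewrite cat_uniq us cons_uniq => /andP[_ ->].
  by rewrite andbT /= -all_predC.
Qed.

Lemma even_cycle_of_arms {G : sgraph} (v w : G) (p q : seq G) :
    path (@adj G) w p -> path (@adj G) w q -> uniq (w :: p ++ q) ->
    v \notin w :: p ++ q -> adj v (last w p) -> adj v (last w q) ->
    last w p != last w q -> ~~ odd (size p + size q) ->
  exists c : seq G, [/\ is_cycle c, v \in c & ~~ odd (size c)].
Proof.
move=> pp pq uw vw vp vq npq ev; exists (w :: q ++ v :: rev p).
have sz: size (w :: q ++ v :: rev p) = (size p + size q).+2.
  by rewrite /= size_cat /= size_rev addnS addnC.
split; last by rewrite sz /= negbK.
- split.
    (* Were both arms empty, both would end at [w]. *)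
    rewrite sz !ltnS lt0n; apply: contra npq.
    by rewrite addn_eq0 => /andP[/nilP-> /nilP->].
  apply/andP; split.
    rewrite /cycle rcons_cat cat_path pq rcons_cons -rev_cons (lastI w p) rev_rcons.
    rewrite /= adj_sym vq vp rev_path.
    by rewrite (eq_path (e' := @adj G)) // => x y; rewrite adj_sym.
  have /perm_uniq->: perm_eq (w :: q ++ v :: rev p) (v :: w :: p ++ q).
    rewrite -cat_cons -[v :: rev p]cat1s perm_catCA cat1s perm_cons /=.
    by rewrite perm_cons perm_catC perm_cat2r perm_rev.
  by rewrite cons_uniq vw.
- by rewrite inE mem_cat mem_head !orbT.
Qed.

Definition avoid {G : sgraph} (v : G) : rel G :=
  fun x y => [&& adj x y, x != v & y != v].

Lemma avoid_sym {G : sgraph} (v : G) : symmetric (avoid v).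
Proof. by move=> x y; rewrite /avoid adj_sym [(x != v) && _]andbC. Qed.

Lemma avoid_path {G : sgraph} (v x : G) s :
  x != v -> path (avoid v) x s -> path (@adj G) x s /\ v \notin x :: s.
Proof.
elim: s x => [|y s IHs] x xv /=; first by rewrite inE eq_sym.
case/andP=> /and3P[xy _ yv] /IHs[//|ps vs].
by rewrite xy inE negb_or eq_sym xv.
Qed.

Lemma three_neighbours_even_cycle {G : sgraph} (v a b c : G) :
    adj v a -> adj v b -> adj v c -> uniq [:: a; b; c] ->
    connect (avoid v) a b -> connect (avoid v) a c ->
  exists c : seq G, [/\ is_cycle c, v \in c & ~~ odd (size c)].
Proof.
move=> va vb vc; rewrite /= !inE negb_or andbT => /andP[/andP[ab ac] bc] cab cac.
have [w [p [q [r [[pp pq pr] [lp lq lr] u]]]]] :=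
  connect_tripod (avoid v) a b c (avoid_sym v) cab cac.
(* Either [w] is [a], a neighbour of [v], or an edge of [avoid v] leaves [w]. *)
have wv: w != v.
  case: (p) pp lp => [_ /= wa|y p' /andP[/and3P[]]//].
  by apply: contraTneq va; rewrite -wa => ->; rewrite adj_irrefl.
have [{}pp vp] := avoid_path v w p wv pp.
have [{}pq vq] := avoid_path v w q wv pq.
have [{}pr vr] := avoid_path v w r wv pr.
have notin s t : v \notin w :: s -> v \notin w :: t -> v \notin w :: s ++ t.
  by rewrite !inE mem_cat !negb_or => /andP[-> ->] /andP[_ ->].
have sub s : subseq s (p ++ q ++ r) -> uniq (w :: s).
  by move=> ss; apply: subseq_uniq u; rewrite /= eqxx.
have: [|| ~~ odd (size p + size q), ~~ odd (size p + size r)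
        | ~~ odd (size q + size r)].
  by rewrite !oddD; do 3!case: (odd _).
case/or3P => ev.
- apply: (even_cycle_of_arms v w p q); rewrite ?lp ?lq ?notin // sub //.
  by rewrite catA prefix_subseq.
- apply: (even_cycle_of_arms v w p r); rewrite ?lp ?lr ?notin // sub //.
  by rewrite cat_subseq ?suffix_subseq.
- apply: (even_cycle_of_arms v w q r); rewrite ?lq ?lr ?notin // sub //.
  by rewrite suffix_subseq.
Qed.

(** Otherwise the edge [vx] would be a bridge: once it is deleted, no walk from [x] can leave the
    component of [x] in G - v. *)
Lemma second_neighbour {G : sgraph} (v x : G) :
    edge_connected 2 G -> adj v x ->
  exists y, [/\ adj v y, y != x & connect (avoid v) x y].
Proof.
move=> [_ hG] vx.
suff /existsP[y /and3P[]]: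
    [exists y, [&& adj v y, y != x & connect (avoid v) x y]] by exists y.
apply: contraT => /existsPn no.
have xv: x != v by apply: contraTneq vx => ->; rewrite adj_irrefl.
have Fe: [set [set v; x]] \subset edges G.
  by rewrite sub1set; apply/imsetP; exists (v, x); rewrite ?inE.
have /connectP[s ps lv] := hG _ Fe ltac:(by rewrite cards1) x v.
suff stay t z : z != v -> connect (avoid v) x z ->
    path (del_edges [set [set v; x]]) z t -> last z t != v.
  by have := stay s x xv (connect0 _ _) ps; rewrite -lv eqxx.
elim: t z => [//|z' t IHt] z zv cz /= /andP[/andP[zz' nF] pt].
have z'v: z' != v.
  (* A step from [z] to [v] makes [z] a neighbour of [v] in the component of [x], so [z] is [x] and
     the step uses the deleted edge. *)
  apply: contraNneq nF => z'v; rewrite z'v in zz' *.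
  have := no z; rewrite adj_sym zz' cz andbT /= negbK => /eqP->.
  by rewrite inE setUC.
apply: IHt pt => //; apply: connect_trans cz (connect1 _).
by rewrite /avoid zz' zv.
Qed.

Theorem theorem5 (G : sgraph) (v : G) (hG : edge_connected 2 G)
    (hv : odd (degree v)) :
  exists c : seq G, [/\ is_cycle c, v \in c & ~~ odd (size c)].
Proof.
pose N := [set w | adj v w].
pose e := avoid v.
have e_csym: connect_sym e by apply/sym_connect_sym/avoid_sym.
have eqv: {in N & &, equivalence_rel (connect e)}.
  move=> x y z _ _ _; split=> [|cxy]; first exact: connect0.
  exact: (same_connect e_csym cxy).
(* The blocks are the traces on [N] of the components of G - v. *)
pose P := equivalence_partition (connect e) N.
have partP: partition P N by apply: equivalence_partitionP.
have [/forall_inP all2|] := boolP [forall A in P, #|A| == 2].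
  move: hv; rewrite /degree -/N.
  rewrite (card_uniform_partition (n := 2) _ partP) ?muln2 ?odd_double //.
  by move=> A /all2 /eqP.
case/forall_inPn=> A /imsetP[x xN ->] n2.
have vx: adj v x by rewrite inE in xN.
have [y [vy yx cxy]] := second_neighbour v x hG vx.
set B := [set _ in N | _] in n2.
have xyB: [set x; y] \subset B.
  by apply/subsetP=> z /set2P[]->; rewrite !inE ?vx ?vy ?connect0.
(* The block [B] contains two vertices but its size is not 2, so it has a third. *)
have /properP[_ [z zB]]: [set x; y] \proper B.
  rewrite properEcard xyB cards2 eq_sym yx ltn_neqAle eq_sym n2 /=.
  by have := subset_leq_card xyB; rewrite cards2 eq_sym yx.
rewrite !inE negb_or => /andP[zx zy].
move: zB; rewrite !inE => /andP[vz cxz].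
apply: (three_neighbours_even_cycle v x y z) => //.
by rewrite /= !inE negb_or eq_sym yx eq_sym zx eq_sym zy.
Qed.
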